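(* Let $w$ be a valuation-transcendental extension of $v$ to $K[x]$, and $f,g\in\mathrm{KP}(w)$. Then $$K(\alpha)|K\text{ is unibranched}\iff K(\beta)|K\text{ is unibranched},$$ for every root $\alpha\in\overline K$ of $f$ and every root $\beta\in\overline K$ of $g$.
   Context: $(K,v)$ is a valued field of arbitrary rank, $\overline K$ a fixed algebraic closure, $\bar v$ a fixed extension of $v$ to $\overline K$, $\Gamma$ an ordered abelian group containing the value group of $\bar v$. A finite extension $L|K$ is unibranched if $v$ has a unique extension to $L$. A valuation on $K[x]$ extending $v$ is a map $w:K[x]\to\Gamma\cup\{\infty\}$ with $w(fg)=w(f)+w(g)$, $w(f+g)\ge\min\{w(f),w(g)\}$, restricting to $v$ on $K$. It is valuation-transcendental if $w^{-1}(\infty)=0$ and the induced valuation on $K(x)$ satisfies: $\Gamma_w/\Gamma_v$ has rational rank $1$, or $k_w|k_v$ has transcendence degree $1$. Key polynomials: $f\sim_w g$ means $w(f-g)>w(f)=w(g)$; $f\mid_w g$ means $g\sim_w fh$ for some $h\in K[x]$. A monic $f\in K[x]$ is a key polynomial for $w$ if $f\mid_w gh$ implies $f\mid_w g$ or $f\mid_w h$, and for every nonzero $g$, $f\mid_w g$ implies $\deg g\ge\deg f$. $\mathrm{KP}(w)$ is the set of key polynomials for $w$. *)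

(* Defs.v *)
From HB Require Import structures.
From mathcomp Require Import all_boot all_order all_algebra all_field.
From mathcomp Require Import generic_quotient.
From mathcomp.multinomials Require Import mpoly.

Set Implicit Arguments.
Unset Strict Implicit.
Unset Printing Implicit Defensive.

Import Order.TTheory GRing.Theory Num.Theory.

Local Open Scope ring_scope.
Local Open Scope quotient_scope.

HB.mixin Record isTotalOrderedZmodule V of Num.POrderedZmodule V := {
  oag_total : forall x y : V, (x <= y) || (y <= x);
  oag_leD2l : forall z x y : V, x <= y -> z + x <= z + y
}.

#[short(type="orderedZmodType")]
HB.structure Definition OrderedZmodule :=
  {V of isTotalOrderedZmodule V & Num.POrderedZmodule V}.

(* The monoid G together with a largest, absorbing element [None], playing *)
(* the role of infinity.                                                   *)
Section WithInfinity.
Variable G : orderedZmodType.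
Implicit Types a b : option G.

Definition vadd a b : option G :=
  if (a, b) is (Some x, Some y) then Some (x + y) else None.

Definition vle a b : bool :=
  match a, b with
  | _, None => true
  | None, Some _ => false
  | Some x, Some y => x <= y
  end.

Definition vlt a b : bool := ~~ vle b a.

Definition vmin a b : option G := if vle a b then a else b.

Lemma vle_refl a : vle a a.
Proof. by case: a => /=. Qed.

Lemma vle_trans b a c : vle a b -> vle b c -> vle a c.
Proof. by case: a b c => [a|] [b|] [c|] //=; apply: le_trans. Qed.

Lemma vle_total a b : vle a b || vle b a.
Proof. by case: a b => [a|] [b|] //=; apply: oag_total. Qed.

Lemma vltW a b : vlt a b -> vle a b.
Proof. by rewrite /vlt => /negbTE ba; have := vle_total a b; rewrite ba orbF. Qed.

Lemma vle_lt_trans b a c : vle a b -> vlt b c -> vlt a c.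
Proof. by move=> ab; apply: contra => ca; apply: vle_trans ca ab. Qed.

Lemma vlt_le_trans b a c : vlt a b -> vle b c -> vlt a c.
Proof. by move=> ab bc; apply: contra ab => ca; apply: vle_trans bc ca. Qed.

Lemma vle_min c a b : vle c (vmin a b) = vle c a && vle c b.
Proof.
rewrite /vmin; case: ifPn => [ab|/vltW ba]; apply/idP/andP.
- by move=> ca; split=> //; apply: vle_trans ca ab.
- by case.
- by move=> cb; split=> //; apply: vle_trans cb ba.
- by case.
Qed.

Lemma vlt_min c a b : vlt c a -> vlt c b -> vlt c (vmin a b).
Proof. by rewrite /vmin; case: ifP. Qed.

Lemma vadd_ge0 a b : vle (Some 0) a -> vle (Some 0) b -> vle (Some 0) (vadd a b).
Proof.
case: a b => [a|] [b|] //= a0 b0; apply: le_trans a0 _.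
by have := oag_leD2l a _ _ b0; rewrite addr0.
Qed.

Lemma vadd_ge0_gt0 a b :
  vle (Some 0) a -> vlt (Some 0) b -> vlt (Some 0) (vadd a b).
Proof.
case: a b => [a|] [b|] //= a0; rewrite /vlt /=; apply: contra => ab0.
by apply: le_trans ab0; have := oag_leD2l b _ _ a0; rewrite addr0 addrC.
Qed.

End WithInfinity.

(* The conditions at 0 and 1 follow from multiplicativity as soon as the   *)
(* map takes both finite and infinite values.  On a field, only 0 is sent  *)
(* to infinity; on a general ring the preimage of infinity is a prime ideal.*)
Record valuation (G : orderedZmodType) (R : comNzRingType) := Valuation {
  val_fun :> R -> option G;
  val0 : val_fun 0 = None;
  val1 : val_fun 1 = Some 0;
  valM : forall x y, val_fun (x * y) = vadd (val_fun x) (val_fun y);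
  valD : forall x y, vle (vmin (val_fun x) (val_fun y)) (val_fun (x + y))
}.

Definition extends (G : orderedZmodType) (R S : comNzRingType) (phi : R -> S)
    (v : valuation G R) (w : valuation G S) : Prop :=
  forall x, w (phi x) = v x.

(* L is given with an embedding phi of F.  Uniqueness is uniqueness among  *)
(* G-valued maps.  When L is algebraic over F this is the same thing as    *)
(* uniqueness up to equivalence of valuations, since G is torsion-free,    *)
(* provided G contains the values of an extension of v to an algebraic     *)
(* closure of F, hence a divisible hull of the value group of v.           *)
Definition unibranched (G : orderedZmodType) (F L : fieldType) (phi : {rmorphism F -> L})
    (v : valuation G F) : Prop :=
  (exists u : valuation G L, extends phi v u) /\
  (forall u1 u2 : valuation G L,
     extends phi v u1 -> extends phi v u2 -> u1 =1 u2).

Section ValuationRing.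
Variables (G : orderedZmodType) (F : fieldType) (v : valuation G F).

Lemma valN1 : v (-1) = Some 0.
Proof.
have := valM v (-1) (-1); rewrite mulrNN mulr1 val1.
case: (v (-1)) => [g|] //= [] g0; congr Some.
case/orP: (oag_total 0 g) => h; apply/eqP; rewrite eq_le h ?andbT /=.
  by have := oag_leD2l g _ _ h; rewrite addr0 -g0.
by have := oag_leD2l g _ _ h; rewrite addr0 -g0.
Qed.

Lemma valN x : v (- x) = v x.
Proof.
rewrite -mulN1r valM valN1; case: (v x) => [g|] //.
by rewrite /vadd add0r.
Qed.

Lemma valV x : x != 0 -> vle (v x) (Some 0) -> vle (Some 0) (v x^-1).
Proof.
move=> x0; have := valM v x x^-1; rewrite divff // val1.
case: (v x) (v x^-1) => [g|] [h|] //= [gh0] g0.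
by have := oag_leD2l h _ _ g0; rewrite addr0 addrC -gh0.
Qed.

Lemma val_neq0 x : x != 0 -> v x != None.
Proof.
move=> x0; have := valM v x x^-1; rewrite divff // val1.
by case: (v x) => //; rewrite /vadd.
Qed.

Definition valring_pred : {pred F} := [pred x | vle (Some 0) (v x)].

Fact valring_subring_closed : subring_closed valring_pred.
Proof.
split=> [|x y|x y]; rewrite !inE ?val1 ?vle_refl // => x0 y0.
  by apply: vle_trans (valD _ _ _); rewrite vle_min valN x0.
by rewrite valM vadd_ge0.
Qed.
HB.instance Definition _ :=
  GRing.isSubringClosed.Build F valring_pred valring_subring_closed.

Record valring := ValRing {
  valring_val :> F;
  valring_valP : valring_val \in valring_pred
}.
HB.instance Definition _ := [isSub for valring_val].
HB.instance Definition _ := [Choice of valring by <:].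
HB.instance Definition _ := [SubChoice_isSubComNzRing of valring by <:].

Definition maxideal : {pred valring} := [pred x | vlt (Some 0) (v (val x))].

Fact maxideal_idealr : idealr_closed maxideal.
Proof.
split=> [||a x y]; rewrite ?inE.
- by rewrite rmorph0 val0.
- by rewrite rmorph1 val1 /vlt vle_refl.
move=> x0 y0; rewrite rmorphD rmorphM /=.
apply: vlt_le_trans (valD _ _ _); apply: vlt_min => //.
by rewrite valM vadd_ge0_gt0 //; apply: (valP a).
Qed.
HB.instance Definition _ := isIdealr.Build valring maxideal maxideal_idealr.

Definition resfield := {ideal_quot maxideal}.
HB.instance Definition _ := GRing.ComNzRing.on resfield.
HB.instance Definition _ := Quotient.on resfield.

Definition resinv (x : resfield) : resfield :=
  if x == 0 then 0 else \pi_resfield (insubd (0 : valring) (val (repr x))^-1).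

Fact resfield_mulVf (x : resfield) : x != 0 -> resinv x * x = 1.
Proof.
move=> x0; rewrite /resinv (negbTE x0) -[X in _ * X]reprK.
have ux : ~~ vlt (Some 0) (v (val (repr x))).
  apply: contra x0 => x0; rewrite -[x]reprK -(rmorph0 (\pi_resfield)) /=.
  by rewrite -Quotient.idealrBE subr0 inE.
rewrite -[LHS](rmorphM (\pi_resfield)) -(rmorph1 (\pi_resfield)); congr (\pi_resfield _).
have r0 : val (repr x) != 0 by apply: contraNneq ux => ->; rewrite val0.
apply: val_inj; rewrite rmorphM rmorph1 /= insubdK ?mulVf //.
by rewrite inE valV // -[vle _ _]negbK.
Qed.

Fact resinv0 : resinv 0 = 0.
Proof. by rewrite /resinv eqxx. Qed.

HB.instance Definition _ :=
  GRing.ComNzRing_isField.Build resfield resfield_mulVf resinv0.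

Definition value_group : G -> Prop := fun g => exists x, v x = Some g.

End ValuationRing.
Arguments maxideal {G F} v.

Section ResidueMap.
Variables (G : orderedZmodType) (F L : fieldType) (phi : {rmorphism F -> L}).
Variables (v : valuation G F) (w : valuation G L) (ext : extends phi v w).

Fact valring_map_subproof (x : valring v) : phi (val x) \in valring_pred w.
Proof. by rewrite inE ext; apply: (valP x). Qed.

Definition valring_map (x : valring v) : valring w :=
  ValRing (valring_map_subproof x).

Definition resmap (x : resfield v) : resfield w :=
  \pi_(resfield w) (valring_map (repr x)).

Lemma resmap_pi (x : valring v) :
  resmap (\pi_(resfield v) x) = \pi_(resfield w) (valring_map x).
Proof.
apply/eqP; rewrite -Quotient.idealrBE inE rmorphB /= -rmorphB ext.
have : repr (\pi_(resfield v) x) - x \in maxideal v.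
  by rewrite Quotient.idealrBE reprK.
by rewrite inE rmorphB.
Qed.

Fact resmap_zmod : zmod_morphism resmap.
Proof.
elim/quotW=> x; elim/quotW=> y; rewrite -[X in resmap X](rmorphB (\pi_(resfield v))).
rewrite !resmap_pi -[RHS](rmorphB (\pi_(resfield w))); congr (\pi_(resfield _) _).
by apply: val_inj; rewrite /= !rmorphB.
Qed.

Fact resmap_monoid : monoid_morphism resmap.
Proof.
split=> [|x y].
  rewrite -(rmorph1 (\pi_(resfield v))) resmap_pi -(rmorph1 (\pi_(resfield w))).
  by congr (\pi_(resfield _) _); apply: val_inj; rewrite /= !rmorph1.
elim/quotW: x => x; elim/quotW: y => y.
rewrite -[X in resmap X](rmorphM (\pi_(resfield v))) !resmap_pi.
rewrite -[RHS](rmorphM (\pi_(resfield w))); congr (\pi_(resfield _) _).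
by apply: val_inj; rewrite /= !rmorphM.
Qed.

HB.instance Definition _ := GRing.isZmodMorphism.Build _ _ resmap resmap_zmod.
HB.instance Definition _ := GRing.isMonoidMorphism.Build _ _ resmap resmap_monoid.

End ResidueMap.

Definition Zfree_mod (G : zmodType) (B : G -> Prop) (n : nat) (g : 'I_n -> G) :=
  forall c : 'I_n -> int, B (\sum_(i < n) g i *~ c i) -> forall i, c i = 0.

(* For subgroups B <= A of G, the quotient A / B has rational rank n, i.e. *)
(* n is the largest size of a Z-linearly independent family in A / B.      *)
Definition rational_rank (G : zmodType) (A B : G -> Prop) (n : nat) : Prop :=
  (exists g : 'I_n -> G, (forall i, A (g i)) /\ Zfree_mod B g) /\
  (forall m (g : 'I_m -> G), (forall i, A (g i)) -> Zfree_mod B g -> (m <= n)%N).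

Definition alg_independent (k l : fieldType) (phi : {rmorphism k -> l})
    (n : nat) (t : 'I_n -> l) : Prop :=
  forall p : {mpoly k[n]}, mmap phi t p = 0 -> p = 0.

Definition trdeg (k l : fieldType) (phi : {rmorphism k -> l}) (n : nat) : Prop :=
  (exists t : 'I_n -> l, alg_independent phi t) /\
  (forall m (t : 'I_m -> l), alg_independent phi t -> (m <= n)%N).

Section Polynomials.
Variables (G : orderedZmodType) (K : fieldType).
Implicit Types (v : valuation G K) (w : valuation G {poly K}).

Definition ratfun_const : {rmorphism K -> {fraction {poly K}}} :=
  @tofrac {poly K} \o polyC.

Lemma extends_fraction v w (W : valuation G {fraction {poly K}}) :
  extends polyC v w -> extends (@tofrac {poly K}) w W -> extends ratfun_const v W.
Proof. by move=> vw wW x; rewrite -vw -wW. Qed.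

(* Hence the W in [valuation_transcendental] is the induced valuation on K(x). *)
Lemma induced_valuation_unique w (W1 W2 : valuation G {fraction {poly K}}) :
  extends (@tofrac {poly K}) w W1 -> extends (@tofrac {poly K}) w W2 -> W1 =1 W2.
Proof.
move=> wW1 wW2; elim/quotW=> r; set x := \pi r.
have xd : x * @tofrac {poly K} \d_r = @tofrac {poly K} \n_r.
  rewrite /x; unlock FracField.tofrac; rewrite -[LHS]FracField.pi_mul; apply/eqP.
  rewrite FracField.equivf_def /FracField.mulf.
  by rewrite !numden_Ratio ?mulr1 ?oner_eq0 ?denom_ratioP // mulrC.
have d0 : @tofrac {poly K} \d_r != 0 by rewrite tofrac_eq0 denom_ratioP.
have := valM W1 x (@tofrac {poly K} \d_r).
have := valM W2 x (@tofrac {poly K} \d_r).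
have /eqP := val_neq0 W1 d0; rewrite xd !wW1 !wW2.
case: (w \d_r) => [d|] // _; case: (w \n_r) (W1 x) (W2 x) => [n|] [a|] [b|] //=.
by move=> [->] [/addIr->].
Qed.

Definition valuation_transcendental v w (vw : extends polyC v w) : Prop :=
  (forall f, w f = None -> f = 0) /\
  exists (W : valuation G {fraction {poly K}})
         (wW : extends (@tofrac {poly K}) w W),
    rational_rank (value_group W) (value_group v) 1 \/
    trdeg (resmap (extends_fraction vw wW)) 1.

Variable w : valuation G {poly K}.
Implicit Types f g h : {poly K}.

Definition equiv_val f g : Prop := vlt (w f) (w (f - g)) /\ w f = w g.

Definition dvd_val f g : Prop := exists h, equiv_val g (f * h).

Definition key_polynomial f : Prop :=
  [/\ f \is monic,
      forall g h, dvd_val f (g * h) -> dvd_val f g \/ dvd_val f h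
    & forall g, g != 0 -> dvd_val f g -> (size f <= size g)%N].

End Polynomials.

(* Main.v *)
(* Let f be a key polynomial for w. Then u_f(h) = w(h mod f) is a valuation     *)
(* with support (f), it satisfies w <= u_f, and it is the only valuation u >= w *)
(* with support (f).                                                            *)
(*                                                                              *)
(* Suppose that u_f is the only extension of v with support (f) and that        *)
(* f <> g. For a root b of g put u_b(h) = vbar(h(b)). Comparing b with the      *)
(* nearest root of f shows that u_b(f) >= w(f) forces u_b >= w, hence           *)
(* u_b = u_g. So u_b(f) <= u_g(f) for every root b of g, with equality only if  *)
(* u_b = u_g. On the other hand                                                 *)
(*   sum_b u_b(f) = sum_{a, b} vbar(a - b) = deg f * u_f(g) = deg g * u_g(f),   *)
(* where the last equality holds because w(f) / deg f is maximal among monic    *)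
(* polynomials or, if f and g are w-equivalent, because deg f = deg g and both  *)
(* sides involve w(f - g). Hence u_b = u_g for all b. As any extension of v     *)
(* with support (g) is bounded below by the minimum of the u_b, it equals u_g.  *)

(* Extensions of [v] to [K(alpha)] correspond to the valuations of [K[x]] that extend [v] and have
   support [(f)] ([unibranchedP]), so by symmetry it suffices to carry uniqueness from [f] to [g]
   ([unique_with_support_key]). The argument above rests on [key_residue_val] for [u_f],
   [val_eq_of_le] for the rigidity of comparable valuations, [root_val_ge] for the nearest root,
   [key_residue_vmuln] for the degree identity and [val_ge_of_roots] for the bound on arbitrary
   extensions. *)
Require Import Defs.
From HB Require Import structures.
From mathcomp Require Import all_boot all_order all_algebra all_field.
Import Order.TTheory GRing.Theory Defs.
Local Open Scope ring_scope.

Set Implicit Arguments.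
Unset Strict Implicit.
Unset Printing Implicit Defensive.

(** * Ordered arithmetic in the group with infinity *)

Section ExtendedGroup.
Variable G : orderedZmodType.
Implicit Types (a b c d : option G) (x y z : G).

Lemma vaddA : associative (@vadd G).
Proof. by case=> [x|] [y|] [z|] //=; rewrite /vadd addrA. Qed.

Lemma vaddC : commutative (@vadd G).
Proof. by case=> [x|] [y|] //=; rewrite /vadd addrC. Qed.

Lemma vadd0 : left_id (Some 0) (@vadd G).
Proof. by case=> [x|] //=; rewrite /vadd add0r. Qed.

HB.instance Definition _ :=
  Monoid.isComLaw.Build (option G) (Some 0) (@vadd G) vaddA vaddC vadd0.

Lemma vaddN a b : vadd a b = None -> a = None \/ b = None.
Proof. by case: a b => [x|] [y|]; auto. Qed.

Lemma vaddIl a : a != None -> injective (vadd a).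
Proof.
by case: a => [x|] // _ [y|] [z|] //=; rewrite /vadd => -[] /addrI->.
Qed.

Lemma vle_anti a b : vle a b -> vle b a -> a = b.
Proof.
by case: a b => [x|] [y|] //= xy yx; congr Some; apply: le_anti; rewrite xy.
Qed.

Lemma vleN a : vle a None. Proof. by case: a. Qed.

Lemma vltNge a b : vlt a b = ~~ vle b a. Proof. by []. Qed.

Lemma vleNgt a b : vle a b = ~~ vlt b a. Proof. by rewrite negbK. Qed.

Lemma vltxx a : vlt a a = false. Proof. by rewrite /vlt vle_refl. Qed.

Lemma vle_eqVlt a b : vle a b -> a = b \/ vlt a b.
Proof.
move=> ab; rewrite vltNge; case: (boolP (vle b a)) => ba; last by right.
by left; apply: vle_anti.
Qed.

Lemma vlt_neqNone a b : vlt a b -> a != None.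
Proof. by case: a b => [x|] [y|]. Qed.

Lemma vle_neqNone a b : vle a b -> b != None -> a != None.
Proof. by case: a b => [x|] [y|]. Qed.

Lemma vle_add2l c a b : vle a b -> vle (vadd c a) (vadd c b).
Proof. by case: c a b => [z|] [x|] [y|] //=; apply: oag_leD2l. Qed.

Lemma vle_add a b c d : vle a b -> vle c d -> vle (vadd a c) (vadd b d).
Proof.
move=> ab cd; apply: vle_trans (vle_add2l a cd) _.
by rewrite ![vadd _ d]vaddC; apply: vle_add2l.
Qed.

Lemma vle_add2lE c a b : c != None -> vle (vadd c a) (vadd c b) = vle a b.
Proof.
move=> c0; apply/idP/idP => [|/vle_add2l->//].
move=> h; have [//|ba] := orP (vle_total a b).
by have /(vaddIl c0)-> := vle_anti h (vle_add2l c ba); apply: vle_refl.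
Qed.

Lemma vlt_add2lE c a b : c != None -> vlt (vadd c a) (vadd c b) = vlt a b.
Proof. by move=> c0; rewrite !vltNge vle_add2lE. Qed.

Lemma vlt_le_add a b c d :
  vlt a b -> vle c d -> c != None -> vlt (vadd a c) (vadd b d).
Proof.
move=> ab cd c0; apply: vlt_le_trans (vle_add2l b cd).
by rewrite ![vadd _ c]vaddC vlt_add2lE.
Qed.

Lemma vle_lt_add a b c d :
  vle a b -> vlt c d -> a != None -> vlt (vadd a c) (vadd b d).
Proof. by move=> ab cd a0; rewrite vaddC (vaddC b); apply: vlt_le_add. Qed.

Definition vmuln a n : option G := iter n (vadd a) (Some 0).

Lemma vmulnS a n : vmuln a n.+1 = vadd a (vmuln a n).
Proof. by []. Qed.

Lemma vmulnD a m n : vmuln a (m + n) = vadd (vmuln a m) (vmuln a n).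
Proof. by elim: m => [|m IH]; rewrite ?vadd0 // addSn !vmulnS IH vaddA. Qed.

Lemma vmuln_neqNone a n : a != None -> vmuln a n != None.
Proof. by case: a => // x _; elim: n => //= n; case: (vmuln _ n). Qed.

Lemma vle_muln a b n : vle a b -> vle (vmuln a n) (vmuln b n).
Proof. by move=> ab; elim: n => [|n IH]; rewrite ?vle_refl // !vmulnS vle_add. Qed.

Lemma vlt_muln a b n : (0 < n)%N -> vlt a b -> vlt (vmuln a n) (vmuln b n).
Proof.
case: n => // n _ ab; rewrite !vmulnS; apply: vlt_le_add => //.
  exact/vle_muln/vltW.
exact/vmuln_neqNone/(vlt_neqNone ab).
Qed.

Lemma big_vadd_const (I : Type) (s : seq I) a :
  \big[@vadd G/Some 0]_(i <- s) a = vmuln a (size s).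
Proof. by rewrite big_const_seq count_predT. Qed.

Lemma vle_big (I : eqType) (s : seq I) (F H : I -> option G) :
  {in s, forall i, vle (F i) (H i)} ->
  vle (\big[@vadd G/Some 0]_(i <- s) F i) (\big[@vadd G/Some 0]_(i <- s) H i).
Proof.
elim: s => [|i s IH] le; first by rewrite !big_nil vle_refl.
rewrite !big_cons vle_add ?IH ?le ?mem_head // => j js.
by apply: le; rewrite in_cons js orbT.
Qed.

Lemma vlt_big (I : eqType) (s : seq I) (F H : I -> option G) :
  {in s, forall i, vle (F i) (H i)} -> {in s, forall i, F i != None} ->
  (exists2 i, i \in s & vlt (F i) (H i)) ->
  vlt (\big[@vadd G/Some 0]_(i <- s) F i) (\big[@vadd G/Some 0]_(i <- s) H i).
Proof.
move=> le fin [i si lti]; rewrite !(big_rem i si) /=.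
have rems j : j \in rem i s -> j \in s by apply: mem_rem.
apply: vlt_le_add => //; first by apply: vle_big => j /rems/le.
elim: (rem i s) rems => [|j r IH] rems; rewrite ?big_nil // big_cons.
have := fin j (rems _ (mem_head _ _)).
have := IH (fun k kr => rems k (mem_behead (s := j :: r) kr)).
by case: (F j) (\big[_/_]_(_ <- _) _) => [x|] [y|].
Qed.

(** Extremality of the sum forces equality termwise; [a] must be finite because adding infinity
    hides strict inequalities. *)
Lemma eq_of_big_vadd (I : eqType) (s : seq I) (F : I -> option G) a :
  a != None -> {in s, forall i, vle (F i) a} ->
  \big[@vadd G/Some 0]_(i <- s) F i = vmuln a (size s) ->
  {in s, forall i, F i = a}.
Proof.
move=> a0 le sumE i si; have [//|lt] := vle_eqVlt (le i si).
have /(@vlt_big _ _ F (fun=> a)) : exists2 i, i \in s & vlt (F i) a by exists i.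
move=> /(_ le (fun j js => vle_neqNone (le j js) a0)).
by rewrite sumE big_vadd_const vltxx.
Qed.

Lemma exists_of_vlt_big (I : eqType) (s : seq I) (F H : I -> option G) :
  vlt (\big[@vadd G/Some 0]_(i <- s) F i) (\big[@vadd G/Some 0]_(i <- s) H i) ->
  exists2 i, i \in s & vlt (F i) (H i).
Proof.
have [/hasP[i si lt] _|/hasPn nlt] := boolP (has (fun i => vlt (F i) (H i)) s).
  by exists i.
by rewrite vltNge vle_big // => i /nlt; rewrite vltNge negbK.
Qed.

Lemma exists_vmax (I : eqType) (s : seq I) (F : I -> option G) :
  s != [::] -> exists2 i, i \in s & {in s, forall j, vle (F j) (F i)}.
Proof.
elim: s => // i [|k s] IH _.
  by exists i; rewrite ?mem_head // => j; rewrite inE => /eqP->; apply: vle_refl.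
have [//|j js max] := IH; have [ij|ji] := orP (vle_total (F i) (F j)).
  exists j; first by rewrite in_cons js orbT.
  by move=> l; rewrite in_cons => /predU1P[->|/max].
exists i; rewrite ?mem_head // => l; rewrite in_cons => /predU1P[->|/max lj].
  exact: vle_refl.
exact: vle_trans lj ji.
Qed.

End ExtendedGroup.

(** * Ultrametric estimates and pullbacks of valuations *)

Section Valuations.
Variables (G : orderedZmodType) (R : comNzRingType) (v : valuation G R).

Lemma val_oppr x : v (- x) = v x.
Proof.
suff vN1 : v (-1) = Some 0 by rewrite -mulN1r valM vN1 vadd0.
have := valM v (-1) (-1); rewrite mulrNN mulr1 val1.
case: (v (-1)) => [g|] //= [] g0; congr Some.
case/orP: (oag_total 0 g) => h; apply/eqP; rewrite eq_le h ?andbT /=.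
  by have := oag_leD2l g _ _ h; rewrite addr0 -g0.
by have := oag_leD2l g _ _ h; rewrite addr0 -g0.
Qed.

Lemma valB x y : vle (vmin (v x) (v y)) (v (x - y)).
Proof. by rewrite -(val_oppr y) valD. Qed.

Lemma val_distrC x y : v (x - y) = v (y - x).
Proof. by rewrite -opprB val_oppr. Qed.

Lemma valX x n : v (x ^+ n) = vmuln (v x) n.
Proof. by elim: n => [|n IH]; rewrite ?val1 // exprS valM IH. Qed.

Lemma val_prod (I : Type) (s : seq I) (F : I -> R) :
  v (\prod_(i <- s) F i) = \big[@vadd G/Some 0]_(i <- s) v (F i).
Proof. exact: (big_morph _ (valM v) (val1 v)). Qed.

Lemma val_sum_gt (I : Type) (s : seq I) (P : pred I) (F : I -> R) a :
  a != None ->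
  (forall i, P i -> vlt a (v (F i))) -> vlt a (v (\sum_(i <- s | P i) F i)).
Proof.
move=> a0 lt; elim/big_rec: _ => [|i x /lt ai ax]; first by rewrite val0; case: a a0 {lt}.
by apply: vlt_le_trans (valD v _ _); apply: vlt_min.
Qed.

Lemma valD_lt x y : vlt (v x) (v y) -> v (x + y) = v x.
Proof.
move=> lt; apply: vle_anti; last first.
  by apply: vle_trans (valD v _ _); rewrite vle_min vle_refl vltW.
have := valB (x + y) y; rewrite addrK.
rewrite /vmin; case: ifP => // _ yx; have := vle_lt_trans yx lt.
by rewrite vltxx.
Qed.

Lemma val_trans c x y z :
  vle c (v (x - y)) -> vle c (v (y - z)) -> vle c (v (x - z)).
Proof.
move=> xy yz; have -> : x - z = (x - y) + (y - z) by rewrite addrA subrK.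
by apply: vle_trans (valD v _ _); rewrite vle_min xy.
Qed.

Lemma val_dist_lt x y z : vlt (v (x - y)) (v (y - z)) -> v (x - z) = v (x - y).
Proof.
move=> lt; have -> : x - z = (x - y) + (y - z) by rewrite addrA subrK.
exact: valD_lt.
Qed.

End Valuations.

Section Pullback.
Variables (G : orderedZmodType) (R S : comNzRingType) (phi : {rmorphism R -> S}).
Variable v : valuation G S.

Fact pullback0 : v (phi 0) = None. Proof. by rewrite rmorph0 val0. Qed.
Fact pullback1 : v (phi 1) = Some 0. Proof. by rewrite rmorph1 val1. Qed.
Fact pullbackM x y : v (phi (x * y)) = vadd (v (phi x)) (v (phi y)).
Proof. by rewrite rmorphM valM. Qed.
Fact pullbackD x y : vle (vmin (v (phi x)) (v (phi y))) (v (phi (x + y))).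
Proof. by rewrite rmorphD valD. Qed.

Definition pullback : valuation G R :=
  Valuation pullback0 pullback1 pullbackM pullbackD.

End Pullback.

(** * Euclidean division by monic polynomials *)

Section PolynomialDivision.
Variable K : fieldType.
Implicit Types f g h : {poly K}.

Lemma monic_divp f h :
  f \is monic -> h \is monic -> (size f <= size h)%N -> h %/ f \is monic.
Proof.
move=> fm hm le; have f0 := monic_neq0 fm; have q0 : h %/ f != 0 by rewrite divpN0.
have := monicP hm; rewrite {1}(divp_eq h f) lead_coefDl.
  by rewrite lead_coef_Mmonic // => q1; apply/monicP.
apply: leq_trans (_ : (size f <= _)%N); first by rewrite ltn_modp.
by rewrite size_mul // -subn1 -addnBAC ?size_poly_gt0 // leq_addl.
Qed.

Lemma modp_monic_same_size f g :
  f \is monic -> g \is monic -> size f = size g -> g %% f = g - f.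
Proof.
move=> fm gm sz; have q1 : g %/ f = 1.
  have qm : g %/ f \is monic by rewrite monic_divp ?sz.
  have /eqP/size_poly1P[c _ qc] : size (g %/ f) = 1%N.
    have : (0 < size g)%N by rewrite size_poly_gt0 monic_neq0.
    by rewrite size_divp ?monic_neq0 // sz; case: (size g) => // n _; rewrite subSnn.
  by move: qm; rewrite qc monicE lead_coefC => /eqP->.
by rewrite {2}(divp_eq g f) q1 mul1r addrC addKr.
Qed.

End PolynomialDivision.

(** * Key polynomials and the valuations [u_f] they induce *)

Section KeyPolynomial.
Variables (G : orderedZmodType) (K : fieldType) (w : valuation G {poly K}).
Hypothesis w_fin : forall h, w h = None -> h = 0.
Implicit Types q r g h : {poly K}.

Section OneKeyPolynomial.
Variable f : {poly K}.
Hypotheses (key_f : key_polynomial w f) (f_gt1 : (1 < size f)%N).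

Let f_neq0 : f != 0. Proof. by rewrite -size_poly_gt0 ltnW. Qed.

Lemma key_dvd_small r : (size r < size f)%N -> dvd_val w f r -> r = 0.
Proof.
move=> lt; case: key_f => _ _ min dvd; apply/eqP.
by apply: contraLR lt => r0; rewrite -leqNgt min.
Qed.

(** If the minimum were not attained, [q * f] and [r] would cancel to leading order, so [f] would
    w-divide [r], forcing [r = 0] by degree. *)
Lemma key_val_division q r :
  (size r < size f)%N -> w (q * f + r) = vmin (w (q * f)) (w r).
Proof.
move=> lt; have le : w (q * f) = w r -> vle (w (q * f + r)) (w r).
  move=> eq_w; rewrite vleNgt; apply/negP => gt; move: (vlt_neqNone gt).
  suff -> : r = 0 by rewrite val0.
  apply: key_dvd_small => //; exists (- q); split.
    by rewrite mulrN opprK mulrC addrC.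
  by rewrite mulrN val_oppr mulrC eq_w.
apply: vle_anti; last exact: valD.
rewrite vle_min; have [/vle_eqVlt[eq_w|lt_w]|/vle_eqVlt[eq_w|lt_w]] :=
  orP (vle_total (w (q * f)) (w r)).
- by rewrite eq_w le.
- by rewrite valD_lt // vle_refl vltW.
- by rewrite -eq_w le.
- by rewrite addrC valD_lt // vle_refl vltW.
Qed.

Lemma key_val_le h : vle (w h) (w (h %/ f * f)) /\ vle (w h) (w (h %% f)).
Proof.
apply/andP; rewrite -vle_min {1}(divp_eq h f) key_val_division ?vle_refl //.
by rewrite ltn_modp.
Qed.

(** Otherwise the multiple of [f] removed by the division would be w-equivalent to [g * h];
    primality would then force [g] or [h] to be zero, where the claim is trivial. *)
Lemma key_val_modp_mul g h :
  (size g < size f)%N -> (size h < size f)%N -> w ((g * h) %% f) = w (g * h).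
Proof.
move=> gf hf; have [_ /vle_eqVlt[//|lt]] := key_val_le (g * h).
have E : (g * h) %/ f * f = g * h - (g * h) %% f.
  by rewrite {2}(divp_eq (g * h) f) addrK.
have : dvd_val w f (g * h).
  exists ((g * h) %/ f); rewrite [f * _]mulrC /equiv_val E subKr; split=> //.
  by rewrite valD_lt ?val_oppr.
case: key_f => _ prime_f _ /prime_f[] /key_dvd_small => [/(_ gf)|/(_ hf)] ->.
  by rewrite mul0r mod0p.
by rewrite mulr0 mod0p.
Qed.

Fact key_residue0 : w (0 %% f) = None. Proof. by rewrite mod0p val0. Qed.
Fact key_residue1 : w (1 %% f) = Some 0.
Proof. by rewrite modp_small ?size_poly1 ?val1. Qed.
Fact key_residueM g h : w ((g * h) %% f) = vadd (w (g %% f)) (w (h %% f)).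
Proof.
rewrite -modp_mul mulrC -modp_mul mulrC key_val_modp_mul ?ltn_modp //.
exact: valM.
Qed.
Fact key_residueD g h :
  vle (vmin (w (g %% f)) (w (h %% f))) (w ((g + h) %% f)).
Proof. by rewrite modpD valD. Qed.

Definition key_residue_val : valuation G {poly K} :=
  Valuation key_residue0 key_residue1 key_residueM key_residueD.

(** As [w] has trivial support, [u_f] has support [(f)], which is therefore a prime ideal. *)
Lemma key_irreducible : irreducible_poly f.
Proof.
split=> // q q1 /dvdpP[c fE].
have := valM key_residue_val c q; rewrite /= -fE modpp val0 => /esym/vaddN[] /w_fin.
  move/modp_eq0P => fc; exfalso.
  have [c0 q0] : c != 0 /\ q != 0 by apply/andP; rewrite -negb_or -mulf_eq0 -fE.
  have := dvdp_leq c0 fc; rewrite fE size_mul //.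
  have := size_poly_gt0 q; rewrite q0; case: (size q) q1 => [|[|n]] // _ _.
  by rewrite addnS /= -[X in (_ <= X)%N]addn0 leq_add2l.
by move/modp_eq0P => fq; rewrite /eqp fq fE dvdp_mull.
Qed.

(** Repeated division: [key_val_le] gives [w h <= w f + w (h %/ f)], and the monic quotient has
    degree smaller by [deg f]. *)
Lemma key_monic_le k h :
  h \is monic -> size h = (k * (size f).-1).+1 -> vle (w h) (vmuln (w f) k).
Proof.
have fm : f \is monic by case: key_f.
elim: k h => [|k IH] h hm sz.
  have /eqP/size_poly1P[c _ hc] := sz.
  by move: hm; rewrite hc monicE lead_coefC => /eqP->; rewrite val1 vle_refl.
have [le _] := key_val_le h; apply: vle_trans le _.
rewrite valM vaddC vmulnS vle_add2l // IH //.
  rewrite monic_divp // sz; case: (size f) f_gt1 => // n _.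
  by rewrite ltnS mulSn leq_addr.
rewrite size_divp // sz; case: (size f) f_gt1 => // n _ /=.
by rewrite mulSn -addnS addKn.
Qed.

(** This is [w g / deg g <= w f / deg f] cleared of denominators; raising [g] to the power [deg f]
    makes its degree a multiple of [deg f]. *)
Lemma key_monic_vmuln_le g : g \is monic ->
  vle (vmuln (w g) (size f).-1) (vmuln (w f) (size g).-1).
Proof.
move=> gm; rewrite -valX; apply: key_monic_le; first exact: monic_exp.
by rewrite -size_exp prednK // size_poly_gt0 monic_neq0 ?monic_exp.
Qed.

End OneKeyPolynomial.

(** Here [g] is w-equivalent to [g %/ f * f], so it w-divides a factor. The nonzero quotient has too
    small a degree, hence the factor is [f]. *)
Lemma key_val_lt_same_size f g :
  key_polynomial w f -> (1 < size f)%N -> key_polynomial w g -> (1 < size g)%N ->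
  vlt (w g) (w (g %% f)) -> size f = size g.
Proof.
move=> key_f f1 key_g g1 lt; have [fm _ _] := key_f; have [gm prime_g min_g] := key_g.
have f0 := monic_neq0 fm; have g0 := monic_neq0 gm.
have fleg : (size f <= size g)%N.
  by rewrite leqNgt; apply: contraL lt => /modp_small->; rewrite vltxx.
have E : g %/ f * f = g - g %% f by rewrite {2}(divp_eq g f) addrK.
have : dvd_val w g (g %/ f * f).
  exists 1; rewrite mulr1 E; split; last by rewrite valD_lt ?val_oppr.
  by rewrite -addrAC subrr add0r !val_oppr valD_lt ?val_oppr.
case/prime_g => [/(key_dvd_small key_g)|/(min_g _ f0)].
  have -> : (size (g %/ f)%R < size g)%N.
    by rewrite size_divp // ltn_subrL size_poly_gt0 g0 andbT -subn1 subn_gt0.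
  by move=> /(_ isT)/eqP; rewrite divp_eq0 (negbTE f0) (negbTE g0) ltnNge fleg.
by move=> glef; apply/eqP; rewrite eqn_leq fleg.
Qed.

(** A shadow of the symmetry of resultants. If neither reduction changes the value,
    [key_monic_vmuln_le] applies both ways; otherwise the degrees agree and both remainders are
    [f - g] up to sign. *)
Lemma key_residue_vmuln f g :
  key_polynomial w f -> (1 < size f)%N -> key_polynomial w g -> (1 < size g)%N ->
  vmuln (w (g %% f)) (size f).-1 = vmuln (w (f %% g)) (size g).-1.
Proof.
move=> key_f f1 key_g g1; have [fm _ _] := key_f; have [gm _ _] := key_g.
have same : size f = size g ->
    vmuln (w (g %% f)) (size f).-1 = vmuln (w (f %% g)) (size g).-1.
  by move=> sz; rewrite !modp_monic_same_size // val_distrC sz.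
have [_ /vle_eqVlt[gf|]] := key_val_le key_f f1 g; last first.
  by move/(key_val_lt_same_size key_f f1 key_g g1)/same.
have [_ /vle_eqVlt[fg|]] := key_val_le key_g g1 f; last first.
  by move/(key_val_lt_same_size key_g g1 key_f f1)/esym/same.
by rewrite -gf -fg; apply: vle_anti; apply: key_monic_vmuln_le.
Qed.

End KeyPolynomial.

(** * Valuations of [K[x]] with a given support *)

Section Support.
Variables (G : orderedZmodType) (K : fieldType) (f : {poly K}).
Hypothesis irr_f : irreducible_poly f.
Implicit Types (u : valuation G {poly K}) (h : {poly K}).

Lemma val_modp u h : u f = None -> u (h %% f) = u h.
Proof.
move=> uf; have uq : u (h %/ f * f) = None by rewrite valM uf; case: (u _).
apply: vle_anti.
  rewrite {2}(divp_eq h f); apply: vle_trans (valD _ _ _).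
  by rewrite vle_min uq vleN vle_refl.
have -> : h %% f = h - h %/ f * f by rewrite {2}(divp_eq h f) addrC addKr.
by apply: vle_trans (valB _ _ _); rewrite vle_min uq vleN vle_refl.
Qed.

Lemma val_dvdp u h : u f = None -> f %| h -> u h = None.
Proof. by move=> uf /modp_eq0P h0; rewrite -val_modp // h0 val0. Qed.

(** A nonzero class [h] modulo [f] has an inverse [b'], and [u b' + u h = 0] for both valuations
    leaves no room for a strict inequality at [h]. *)
Lemma val_eq_of_le u1 u2 :
  u1 f = None -> u2 f = None -> (forall h, vle (u1 h) (u2 h)) -> u1 =1 u2.
Proof.
move=> u1f u2f le h; have [fh|Nfh] := boolP (f %| h).
  by rewrite (val_dvdp u1f fh) (val_dvdp u2f fh).
have : coprimep f h by rewrite irreducible_poly_coprime.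
case/Bezout_coprimepP=> -[a b] /=; rewrite -size_poly_eq1 => /size_poly1P[c c0 E].
pose b' := c^-1 *: b.
have inv u : u f = None -> vadd (u b') (u h) = Some 0.
  move=> uf; rewrite -valM -(val1 u) -(val_modp _ uf) -[RHS](val_modp _ uf).
  congr (u _); have -> : b' * h = 1 + (- (c^-1 *: a)) * f.
    rewrite mulNr -!scalerAl; apply/eqP; rewrite eq_sym subr_eq addrC -scalerDr E.
    by rewrite -mul_polyC -polyCM mulVf.
  by rewrite modpD modp_mull addr0.
apply: vle_anti; rewrite // vleNgt; apply/negP => lt.
have : vlt (vadd (u1 b') (u1 h)) (vadd (u2 b') (u2 h)).
  apply: vle_lt_add => //.
  by have := inv u1 u1f; case: (u1 b').
by rewrite !inv // vltxx.
Qed.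

End Support.

(** * Characteristic polynomials of residue classes *)

Section SpectralMapping.
Variable K : fieldType.

Lemma horner_mx_comp n (A : 'M[K]_n.+1) (p q : {poly K}) :
  horner_mx A (p \Po q) = horner_mx (horner_mx A q) p.
Proof.
elim/poly_ind: p => [|p c IH]; first by rewrite comp_poly0 !rmorph0.
by rewrite comp_poly_MXaddC !rmorphD !rmorphM /= IH !horner_mx_C horner_mx_X.
Qed.

(** Apply the linear factors one at a time: the last nonzero vector is an eigenvector. *)
Lemma horner_mx_prod_kernel n (A : 'M[K]_n.+1) (x : 'rV_n.+1) (s : seq K) :
  x != 0 -> x *m horner_mx A (\prod_(z <- s) ('X - z%:P)) = 0 ->
  exists2 z, z \in s & root (char_poly A) z.
Proof.
elim: s x => [|z s IH] x x0.
  by rewrite big_nil rmorph1 mulmx1 => /eqP; rewrite (negbTE x0).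
rewrite big_cons rmorphM /= -[_ * _]/(_ *m _) mulmxA.
have [E _|/IH{}IH /IH[y ys ry]] := eqVneq (x *m horner_mx A ('X - z%:P)) 0.
  exists z; rewrite ?mem_head // -eigenvalue_root_char; apply/eigenvalueP.
  exists x => //; move: E; rewrite rmorphB /= horner_mx_X horner_mx_C mulmxBr.
  by rewrite mul_mx_scalar => /eqP; rewrite subr_eq0 => /eqP.
by exists y; rewrite // in_cons ys orbT.
Qed.

End SpectralMapping.

(* [r] is the characteristic polynomial of [h] acting on [K[x]/(g)]. *)
Lemma exists_annihilating_poly (K : fieldType) (L : closedFieldType)
    (iota : {rmorphism K -> L}) (g h : {poly K}) :
  irreducible_poly g -> g \is monic ->
  exists2 r : {poly K}, r \is monic /\ g %| r \Po h
    & forall t, root (map_poly iota r) t ->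
        exists2 b, root (map_poly iota g) b & t = (map_poly iota h).[b].
Proof.
move=> irr_g gm.
have [n [A charA]] : exists n (A : 'M[K]_n.+1), char_poly A = g.
  have := companionmxK gm; move: (companionmx g).
  have [g1 _] := irr_g; case: (size g) g1 => [|[|n]] // _ A E.
  by exists n, A.
exists (char_poly (horner_mx A h)).
  split; first exact: char_poly_monic.
  (* Irreducibility makes [g] the minimal polynomial of [A], so Cayley-Hamilton for [h(A)] yields
     divisibility by [g]. *)
  have minA : mxminpoly A %= g.
    have [_ irr] := irr_g; apply: irr; last by rewrite -charA mxminpoly_dvd_char.
    by rewrite size_mxminpoly eqSS -lt0n mxminpoly_nonconstant.
  rewrite -(eqp_dvdl _ minA); apply: mxminpoly_min.
  by rewrite horner_mx_comp Cayley_Hamilton.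
move=> t; rewrite map_char_poly map_horner_mx -eigenvalue_root_char.
case/eigenvalueP=> x xE x0; set A' := map_mx iota A in xE.
have {}xE : x *m horner_mx A' (map_poly iota h - t%:P) = 0.
  by rewrite rmorphB /= horner_mx_C mulmxBr mul_mx_scalar xE subrr.
have charA' : char_poly A' = map_poly iota g by rewrite -map_char_poly charA.
have [s hE] := closed_field_poly_normal (map_poly iota h - t%:P).
have hroot b : root (map_poly iota h - t%:P) b -> t = (map_poly iota h).[b].
  by rewrite rootE !hornerE subr_eq0 => /eqP->.
have [h0|c0] := eqVneq (map_poly iota h - t%:P) 0.
  have : size (map_poly iota g) != 1%N.
    by rewrite size_map_poly; case: irr_g => + _; case: (size g) => [|[]].
  case/closed_rootP=> b rb; exists b => //; apply: hroot.
  by rewrite h0 root0.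
have c0' : lead_coef (map_poly iota h - t%:P) != 0 by rewrite lead_coef_eq0.
move: xE; rewrite hE -mul_polyC rmorphM /= horner_mx_C -[_ * _]/(_ *m _).
rewrite mul_scalar_mx -scalemxAr => /eqP.
rewrite scaler_eq0 (negbTE c0') => /eqP/(horner_mx_prod_kernel x0)[b bs].
rewrite charA' => rb; exists b => //; apply: hroot.
by rewrite hE rootZ // root_prod_XsubC.
Qed.

(** * Valuations over an algebraically closed field *)

Section ClosedFieldValuation.
Variables (G : orderedZmodType) (L : closedFieldType) (nu : valuation G L).

Lemma val_horner_prod (s : seq L) x :
  nu (\prod_(z <- s) ('X - z%:P)).[x] = \big[@vadd G/Some 0]_(z <- s) nu (z - x).
Proof.
rewrite horner_prod val_prod; apply: eq_bigr => z _.
by rewrite !hornerE val_distrC.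
Qed.

(** Factor [p] over its roots: a larger value at [y] requires some factor to be larger at [y] than
    at [x]. *)
Lemma exists_closer_root (p : {poly L}) x y :
  vlt (nu p.[x]) (nu p.[y]) -> exists2 z, root p z & vlt (nu (x - z)) (nu (y - z)).
Proof.
have [->|p0] := eqVneq p 0; first by rewrite !horner0 vltxx.
have [s pE] := closed_field_poly_normal p.
have c0 : lead_coef p != 0 by rewrite lead_coef_eq0.
rewrite pE !hornerZ !valM vlt_add2lE ?val_neq0 // !val_horner_prod.
case/exists_of_vlt_big=> z zs lt; exists z.
  by rewrite rootZ // root_prod_XsubC.
by rewrite -(val_distrC nu z x) -(val_distrC nu z y).
Qed.

(** Up to sign the coefficient is the elementary symmetric polynomial of degree [size s - k] in the
    roots. *)
Lemma val_coef_prod_XsubC (s : seq L) a k :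
  {in s, forall z, vle a (nu z)} -> (k <= size s)%N ->
  vle (vmuln a (size s - k)) (nu (\prod_(z <- s) ('X - z%:P))`_k).
Proof.
elim: s k => [|z s IH] k le ks.
  by move: ks; rewrite leqn0 => /eqP->; rewrite big_nil coefC val1 vle_refl.
have {}IH := IH _ (fun y ys => le y (mem_behead (s := z :: s) ys)).
have az : vle a (nu z) := le z (mem_head _ _).
rewrite big_cons; set P := \prod_(_ <- s) _ in IH *.
have low j : (j <= size s)%N -> vle (vmuln a (size s - j).+1) (nu (z * P`_j)).
  by move=> js; rewrite valM vmulnS vle_add ?IH.
rewrite mulrBl coefB coefCM coefXM; apply: vle_trans (valB _ _ _).
rewrite vle_min; apply/andP; split.
  case: k ks => [|k] ks; first by rewrite val0 vleN.
  by rewrite /= subSS IH.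
have [ks'|sk] := leqP k (size s); first by rewrite subSn // low.
by rewrite nth_default ?mulr0 ?val0 ?vleN // size_prod_XsubC.
Qed.

Section RootValuations.
Variables (K : fieldType) (iota : {rmorphism K -> L}).

Definition root_val (b : L) : valuation G {poly K} :=
  pullback (horner_eval b \o map_poly iota) nu.

Lemma root_valE b h : root_val b h = nu (map_poly iota h).[b]. Proof. by []. Qed.

Variable v : valuation G K.
Hypothesis v_nu : extends iota v nu.

Lemma root_val_extends b : extends polyC v (root_val b).
Proof. by move=> x; rewrite root_valE map_polyC hornerC v_nu. Qed.

Lemma root_val_root f b : root (map_poly iota f) b -> root_val b f = None.
Proof. by rewrite root_valE => /rootP->; rewrite val0. Qed.

(** Let [r] annihilate [h] modulo [g], with roots among the [h(b)]. Were [u h < a], the top term of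
    [r \Po h] would strictly dominate and give it finite value, although [g] divides it. *)
Lemma val_ge_of_roots (g h : {poly K}) (u : valuation G {poly K}) a :
  irreducible_poly g -> g \is monic -> extends polyC v u -> u g = None ->
  (forall b, root (map_poly iota g) b -> vle a (root_val b h)) -> vle a (u h).
Proof.
move=> irr_g gm v_u ug le; rewrite vleNgt; apply/negP => lt.
have [r [rm gr] rroot] := exists_annihilating_poly iota h irr_g gm.
have [s rE] := closed_field_poly_normal (map_poly iota r).
have {}rE : map_poly iota r = \prod_(z <- s) ('X - z%:P).
  by rewrite rE lead_coef_map (monicP rm) rmorph1 scale1r.
have ge z : z \in s -> vle a (nu z).
  by rewrite -root_prod_XsubC -rE => /rroot[b /le] + ->.
have size_r : size r = (size s).+1.
  by rewrite -(size_map_poly iota) rE size_prod_XsubC.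
have uh0 := vlt_neqNone lt.
suff : u (r \Po h) = vmuln (u h) (size s).
  by rewrite (val_dvdp ug gr) => /esym/eqP; apply/negP/vmuln_neqNone.
rewrite comp_polyE size_r big_ord_recr /= addrC.
have -> : r`_(size s) = 1.
  by move: (monicP rm); rewrite lead_coefE size_r.
rewrite scale1r valD_lt valX //; apply: val_sum_gt; first exact: vmuln_neqNone.
move=> k _; have ks := ltn_ord k.
rewrite -mul_polyC valM valX v_u -v_nu -coef_map rE.
rewrite -{1}(subnK (ltnW ks)) vmulnD; apply: vlt_le_add (vle_refl _) _.
  apply: vlt_le_trans (val_coef_prod_XsubC ge (ltnW ks)).
  by rewrite vlt_muln // subn_gt0.
exact: vmuln_neqNone.
Qed.

End RootValuations.
End ClosedFieldValuation.

(** * Comparison with the nearest root of [f] *)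

Section UnibranchedKeyPolynomial.
Variables (G : orderedZmodType) (K : fieldType) (L : closedFieldType).
Variables (iota : {rmorphism K -> L}) (nu : valuation G L).
Variables (w : valuation G {poly K}).
Hypothesis w_fin : forall h, w h = None -> h = 0.
Variable f : {poly K}.
Hypotheses (key_f : key_polynomial w f) (f_gt1 : (1 < size f)%N).
Hypothesis root_val_f : forall a h,
  root (map_poly iota f) a -> root_val nu iota a h = w (h %% f).

Variable s : seq L.
Hypothesis fE : map_poly iota f = \prod_(a <- s) ('X - a%:P).

Let f_neq0 : f != 0. Proof. by rewrite -size_poly_gt0 ltnW. Qed.

Let rootE a : root (map_poly iota f) a = (a \in s).
Proof. by rewrite fE root_prod_XsubC. Qed.

Let val_f b : root_val nu iota b f = \big[@vadd G/Some 0]_(a <- s) nu (a - b).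
Proof. by rewrite root_valE fE val_horner_prod. Qed.

Let s_neq0 : s != [::].
Proof.
move: f_gt1; rewrite -(size_map_poly iota) fE size_prod_XsubC ltnS.
by rewrite -size_eq0 lt0n.
Qed.

Let root_val_small a (h : {poly K}) : a \in s -> (size h < size f)%N ->
  root_val nu iota a h = w h.
Proof. by rewrite -rootE => /root_val_f-> lt; rewrite modp_small. Qed.

Let nearest b : exists2 a, a \in s & forall c, c \in s -> vle (nu (c - b)) (nu (a - b)).
Proof. exact: exists_vmax. Qed.

(* Descent on [size h]: if [f] were too large at [b], then [r = f mod h] would *)
(* be larger at [b] than at the root [a] of [f] nearest to [b], so [r] would   *)
(* have a root [e] closer to [b] than [a] is, and [f] takes the same value at  *)
(* [e] as at [b].                                                              *)
Lemma val_at_small_root (h : {poly K}) b : h != 0 -> (size h < size f)%N ->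
  root (map_poly iota h) b -> vle (root_val nu iota b f) (w f).
Proof.
have [n] := ubnP (size h); elim: n => // n IH in h b *.
rewrite ltnS => hn h0 hf hb; rewrite vleNgt; apply/negP => lt.
have h1 : (1 < size h)%N.
  rewrite -(size_map_poly iota); apply: root_size_gt1 hb.
  by rewrite map_poly_eq0.
set r := f %% h; have rh : (size r < size h)%N by rewrite ltn_modp.
have rf := ltn_trans rh hf.
have qf : (size (f %/ h)%R < size f)%N.
  by rewrite size_divp // ltn_subrL size_poly_gt0 f_neq0 andbT -subn1 subn_gt0.
have r0 : r != 0.
  apply/negP => /eqP/modp_eq0P hdvd.
  have [_ irr] := key_irreducible w_fin key_f f_gt1.
  have := irr h; rewrite neq_ltn h1 orbT => /(_ isT hdvd)/eqp_size sz.
  by move: hf; rewrite sz ltnn.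
have valr : root_val nu iota b f = root_val nu iota b r.
  rewrite !root_valE {1}(divp_eq f h) rmorphD rmorphM hornerD hornerM.
  by rewrite (rootP hb) mulr0 add0r.
have [a as_ amax] := nearest b.
(* At the root [a] of [f] the product [f %/ h * h] equals [- r], and [w] agrees with evaluation at
   [a] in small degree, so this product and [r] have the same [w]-value. *)
have wr : vle (w r) (w f).
  rewrite {1}(divp_eq f h) -/r; apply: vle_trans (valD _ _ _).
  rewrite vle_min vle_refl andbT.
  rewrite valM -!(root_val_small as_) // -valM.
  have -> : f %/ h * h = f - r by rewrite {2}(divp_eq f h) addrK.
  apply: vle_trans (valB _ _ _); rewrite vle_min vle_refl andbT.
  by rewrite (root_val_root nu (f := f)) ?vleN // rootE.
have : vlt (root_val nu iota a r) (root_val nu iota b r).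
  by rewrite root_val_small // -valr; apply: vle_lt_trans wr lt.
case/exists_closer_root=> e er closer.
have ab : nu (a - b) = nu (a - e).
  by rewrite (@val_dist_lt _ _ nu a e b) // (val_distrC nu e).
suff fe : root_val nu iota e f = root_val nu iota b f.
  by move: lt; rewrite -fe vltNge (IH r) // (leq_trans rh).
rewrite !val_f; apply: eq_big_seq => c cs.
apply: val_dist_lt; apply: vle_lt_trans (amax c cs) _.
by rewrite ab.
Qed.

(* If [h] of small degree violates the bound at [b], then some root [c] of [h] *)
(* is closer than [b] to the root [a] of [f] nearest to [b], so that [f] is    *)
(* larger at [c] than at [b], against [val_at_small_root].                     *)
Lemma root_val_ge b : vle (w f) (root_val nu iota b f) ->
  forall h, vle (w h) (root_val nu iota b h).
Proof.
move=> le.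
have small (h : {poly K}) : (size h < size f)%N -> vle (w h) (root_val nu iota b h).
  move=> hf; rewrite vleNgt; apply/negP => lt.
  have h0 : h != 0 by apply: contraTneq lt => ->; rewrite val0 vltNge vleN.
  have [a as_ amax] := nearest b.
  move: (lt); rewrite -(root_val_small as_) // => /exists_closer_root[c hc closer].
  have ba : nu (b - a) = nu (b - c).
    by apply: val_dist_lt; rewrite (val_distrC nu c).
  have := val_at_small_root h0 hf hc; rewrite vleNgt => /negP; apply.
  apply: vle_lt_trans le _; rewrite !val_f; apply: vlt_big.
  - move=> d ds; apply: val_trans (vle_refl _) _.
    by rewrite -ba (val_distrC nu b) amax.
  - move=> d ds; apply: vle_neqNone (amax d ds) _.
    by rewrite (val_distrC nu) ba (vlt_neqNone closer).
  - by exists a; rewrite // (val_distrC nu) ba.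
move=> h; have [n] := ubnP (size h); elim: n => // n IH in h *; rewrite ltnS => hn.
have [hf|fh] := ltnP (size h) (size f); first exact: small.
have h_gt0 : (0 < size h)%N by apply: leq_trans fh; apply: ltnW.
rewrite {2}(divp_eq h f); apply: vle_trans (valD _ _ _).
rewrite vle_min; apply/andP; split.
  have [wle _] := key_val_le key_f f_gt1 h; apply: vle_trans wle _; rewrite !valM.
  apply: vle_add => //; apply: IH; apply: leq_trans hn.
  by rewrite size_divp // ltn_subrL h_gt0 andbT -subn1 subn_gt0.
have [_ wle] := key_val_le key_f f_gt1 h; apply: vle_trans wle _.
by apply: small; rewrite ltn_modp.
Qed.

End UnibranchedKeyPolynomial.

(** For irreducible [f], the condition [u f = None] already forces support [(f)]. Existence is left
    out, since a root of [f] supplies it. *)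
Definition unique_with_support (G : orderedZmodType) (K : fieldType)
    (v : valuation G K) (f : {poly K}) : Prop :=
  forall u1 u2 : valuation G {poly K}, extends polyC v u1 -> extends polyC v u2 ->
    u1 f = None -> u2 f = None -> u1 =1 u2.

(** * Simple extensions as quotients of [K[x]] *)

Section SimpleExtension.
Variables (G : orderedZmodType) (K L : fieldType) (iota : {rmorphism K -> L}).
Variables (f : {poly K}) (z : L).
Hypotheses (irr_f : irreducible_poly f) (fz : root (map_poly iota f) z).

Let f0 : f != 0. Proof. exact: irredp_neq0. Qed.

Lemma subfx_eval_eq0 h : (subfx_eval iota z f h == 0) = (f %| h).
Proof.
rewrite -(fmorph_eq0 (@subfx_inj _ _ iota z f)) /= subfx_inj_eval //.
apply/idP/idP => [hz|/dvdpP[q ->]]; last first.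
  by rewrite rmorphM hornerM (rootP fz) mulr0.
apply/modp_eq0P/eqP; have min := (subfx_irreducibleP fz f0).2 irr_f (h %% f).
apply: contraLR (ltn_modpN0 h f0) => r0; rewrite -leqNgt min //.
move: hz; rewrite {1}(divp_eq h f) rmorphD rmorphM hornerD hornerM.
by rewrite (rootP fz) mulr0 add0r.
Qed.

(** Such a [u] depends only on classes modulo [f], so any choice [lift] of representatives
    transports it to the quotient. *)
Lemma exists_subfx_val (u : valuation G {poly K}) : u f = None ->
  exists U : valuation G (subFExtend iota z f), forall h, U (subfx_eval iota z f h) = u h.
Proof.
move=> uf; pose lift x := sval (sig_eqW (@subfxE _ _ iota z f x)).
have liftK x : subfx_eval iota z f (lift x) = x.
  by rewrite /lift; case: sig_eqW => p /= ->.
have lift_eval h : u (lift (subfx_eval iota z f h)) = u h.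
  have : f %| lift (subfx_eval iota z f h) - h.
    by rewrite -subfx_eval_eq0 rmorphB /= liftK subrr.
  rewrite -(val_modp _ uf) -(val_modp h uf).
  move/modp_eq0P => E; congr (u _); apply/eqP; rewrite -subr_eq0 -E.
  by rewrite modpD modpN.
pose U x := u (lift x).
have U0 : U 0 = None by rewrite /U -(rmorph0 (subfx_eval iota z f)) lift_eval val0.
have U1 : U 1 = Some 0 by rewrite /U -(rmorph1 (subfx_eval iota z f)) lift_eval val1.
have UM x y : U (x * y) = vadd (U x) (U y).
  by rewrite /U -{1}[x]liftK -{1}[y]liftK -rmorphM lift_eval valM.
have UD x y : vle (vmin (U x) (U y)) (U (x + y)).
  rewrite /U -{2}[x]liftK -{2}[y]liftK -rmorphD lift_eval; exact: valD.
by exists (Valuation U0 U1 UM UD) => h /=; rewrite /U lift_eval.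
Qed.

Lemma unibranchedP (v : valuation G K) (nu : valuation G L) :
  extends iota v nu ->
  unibranched (inj_subfx iota z f) v <-> unique_with_support v f.
Proof.
move=> v_nu; split=> [[_ uniq] u1 u2 v_u1 v_u2 u1f u2f h|uniq].
  have [U1 U1E] := exists_subfx_val u1f; have [U2 U2E] := exists_subfx_val u2f.
  rewrite -U1E -U2E; apply: uniq => x.
    by rewrite [LHS]U1E v_u1.
  by rewrite [LHS]U2E v_u2.
split.
  exists (pullback (@subfx_inj _ _ iota z f) nu) => x.
  by rewrite [LHS]/= -v_nu subfx_inj_eval // map_polyC hornerC.
move=> U1 U2 v_U1 v_U2 x; have [h ->] := subfxE x.
pose p (U : valuation G (subFExtend iota z f)) := pullback (subfx_eval iota z f) U.
have pf U : p U f = None.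
  by rewrite /= (eqP (_ : subfx_eval iota z f f == 0)) ?val0 // subfx_eval_eq0.
exact: (uniq (p U1) (p U2) v_U1 v_U2 (pf U1) (pf U2)).
Qed.

End SimpleExtension.

(** * Passing uniqueness from one key polynomial to another *)

Lemma unique_with_support_key (G : orderedZmodType) (K : fieldType)
    (L : closedFieldType) (iota : {rmorphism K -> L})
    (v : valuation G K) (nu : valuation G L) (w : valuation G {poly K})
    (f g : {poly K}) :
  extends iota v nu -> extends polyC v w -> (forall h, w h = None -> h = 0) ->
  key_polynomial w f -> (1 < size f)%N -> key_polynomial w g -> (1 < size g)%N ->
  unique_with_support v f -> unique_with_support v g.
Proof.
move=> v_nu v_w w_fin key_f f1 key_g g1 uniq_f.
have [-> //|fg] := eqVneq g f.
have [fm _ _] := key_f; have [gm _ _] := key_g.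
have irr_f := key_irreducible w_fin key_f f1.
have irr_g := key_irreducible w_fin key_g g1.
pose uf := key_residue_val key_f f1; pose ug := key_residue_val key_g g1.
have val_small (p : {poly K}) : (1 < size p)%N -> forall x, w (x%:P %% p) = v x.
  by move=> p1 x; rewrite modp_small ?v_w // (leq_ltn_trans (size_polyC_leq1 x)).
have ugg : ug g = None by rewrite /= modpp val0.
(* Uniqueness for [f] enters here: it identifies every [u_a] with [u_f]. *)
have root_f a h : root (map_poly iota f) a -> root_val nu iota a h = w (h %% f).
  move=> fa; apply: (uniq_f _ uf); first exact: root_val_extends.
  - exact: val_small.
  - exact: root_val_root.
  - by rewrite /= modpp val0.
have split_monic p : p \is monic ->
    exists s, map_poly iota p = \prod_(a <- s) ('X - a%:P).
  move=> pm; have [s sE] := closed_field_poly_normal (map_poly iota p).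
  by exists s; rewrite sE lead_coef_map (monicP pm) rmorph1 scale1r.
have [sf fE] := split_monic f fm; have [sg gE] := split_monic g gm.
have size_sf : size sf = (size f).-1.
  by rewrite -(size_map_poly iota) fE size_prod_XsubC.
have size_sg : size sg = (size g).-1.
  by rewrite -(size_map_poly iota) gE size_prod_XsubC.
(* On remainders modulo [g], the bound [u_b >= w] reads [u_b >= u_g], which [val_eq_of_le] turns
   into equality. *)
have root_ge b : root (map_poly iota g) b -> vle (w f) (root_val nu iota b f) ->
    root_val nu iota b =1 ug.
  move=> gb le h; apply/esym.
  apply: (val_eq_of_le irr_g ugg (root_val_root nu gb)) => {}h.
  rewrite -(val_modp h (root_val_root nu gb)).
  exact: (root_val_ge w_fin key_f f1 root_f fE le).
have ugf_fin : w (f %% g) != None.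
  apply/eqP => /w_fin/modp_eq0P gf; have [_ irr] := irr_f.
  have := irr g; rewrite neq_ltn g1 orbT => /(_ isT gf).
  by rewrite eqp_monic // (negbTE fg).
have root_le b : root (map_poly iota g) b ->
    vle (root_val nu iota b f) (w (f %% g)).
  move=> gb; have [/(root_ge b gb)->|/vltW le] :=
    boolP (vle (w f) (root_val nu iota b f)); first exact: vle_refl.
  by apply: vle_trans le _; have [] := key_val_le key_g g1 f.
(* Both sides are the double sum of [vbar (a - b)] over the roots of [f] and [g], taken in the two
   orders. *)
have sumE : \big[@vadd G/Some 0]_(b <- sg) root_val nu iota b f =
    vmuln (w (f %% g)) (size sg).
  rewrite size_sg -(key_residue_vmuln key_f f1 key_g g1) -size_sf -big_vadd_const.
  transitivity (\big[@vadd G/Some 0]_(a <- sf) root_val nu iota a g); last first.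
    by apply: eq_big_seq => a asf; rewrite root_f // fE root_prod_XsubC.
  under eq_bigr do rewrite root_valE fE val_horner_prod.
  rewrite exchange_big; apply: eq_bigr => a _.
  rewrite root_valE gE val_horner_prod; apply: eq_bigr => b _.
  exact: val_distrC.
have root_g b : root (map_poly iota g) b -> root_val nu iota b =1 ug.
  move=> gb; apply: root_ge => //.
  have bsg : b \in sg by rewrite -root_prod_XsubC -gE.
  rewrite (@eq_of_big_vadd _ _ sg (fun b => root_val nu iota b f) _ ugf_fin _ sumE) //.
    by have [] := key_val_le key_g g1 f.
  by move=> c csg; apply: root_le; rewrite gE root_prod_XsubC.
have to_ug u : extends polyC v u -> u g = None -> ug =1 u.
  move=> v_u u_g; apply: (val_eq_of_le irr_g ugg u_g) => h.
  apply: (val_ge_of_roots v_nu irr_g gm v_u u_g) => b /root_g->.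
  exact: vle_refl.
by move=> u1 u2 v_u1 v_u2 u1g u2g h; rewrite -(to_ug u1) // -(to_ug u2).
Qed.

Theorem proposition3p9
  (G : orderedZmodType) (K : fieldType) (Kbar : closedFieldType)
  (iota : {rmorphism K -> Kbar}) (algKbar : forall z, algebraicOver iota z)
  (v : valuation G K) (vbar : valuation G Kbar) (vvbar : extends iota v vbar)
  (w : valuation G {poly K}) (vw : extends polyC v w)
  (wvt : valuation_transcendental vw)
  (f g : {poly K}) (kpf : key_polynomial w f) (kpg : key_polynomial w g)
  (alpha beta : Kbar)
  (falpha : root (map_poly iota f) alpha) (gbeta : root (map_poly iota g) beta) :
  unibranched (inj_subfx iota alpha f) v <-> unibranched (inj_subfx iota beta g) v.
Proof.
have [w_fin _] := wvt; have [fm _ _] := kpf; have [gm _ _] := kpg.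
(* The constant 1 also satisfies [key_polynomial]; having a root excludes it. *)
have f1 : (1 < size f)%N.
  by rewrite -(size_map_poly iota) (root_size_gt1 _ falpha) // map_poly_eq0 monic_neq0.
have g1 : (1 < size g)%N.
  by rewrite -(size_map_poly iota) (root_size_gt1 _ gbeta) // map_poly_eq0 monic_neq0.
have irr_f := key_irreducible w_fin kpf f1.
have irr_g := key_irreducible w_fin kpg g1.
have Uf := unibranchedP irr_f falpha vvbar.
have Ug := unibranchedP irr_g gbeta vvbar.
split.
  by move/Uf/(unique_with_support_key vvbar vw w_fin kpf f1 kpg g1)/Ug.
by move/Ug/(unique_with_support_key vvbar vw w_fin kpg g1 kpf f1)/Uf.
Qed.
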